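(* Let $p\in(0,1)$ and $q\in(0,1)$. For integers $x\ge1$ let $Y_x$ be the distribution $Y_x(y)=\binom{x}{y-x}(1-p)^{2x-y}p^{y-x}$, $y=x,x+1,\dots,2x$. For integers $y\ge1$ let $g(y)=\Lambda_1(y)-\Lambda_2(y)-\Lambda_3(y)$, where $\Lambda_i(y)=\int_0^1f_i(y,t)\,dt$ and $$f_1(y,t)=\frac{1-\frac{ty}{1+p}}{t\log(1-t)}-\frac{\left(\sqrt{(1+p)^2-4pt}-(1-p)\right)^y}{(2p)^y\,t\log(1-t)},$$ $$f_2(y,t)=\frac{1-\frac{typ}{1+p}}{t\log(1-t)}-\frac{\left(\sqrt{(1+p)^2-4p^2t}-(1-p)\right)^y}{(2p)^y\,t\log(1-t)},$$ $$f_3(y,t)=\frac{1-\frac{ty(1-p)}{1+p}}{t\log(1-t)}-\frac{\left(\sqrt{(1+p)^2-4p(1-p)t}-(1-p)\right)^y}{(2p)^y\,t\log(1-t)}.$$ Then $\sum_{y=1}^\infty q^y\exp(g(y)-yh(p)/(1+p))<\infty$, so that, with $y_0$ the reciprocal of this sum, $Y^{(q)}(y)=y_0q^y\exp(g(y)-yh(p)/(1+p))$, $y=1,2,\dots$, is a probability distribution; and for all integers $x\ge1$, $$D_{\mathsf{KL}}(Y_x\|Y^{(q)})=-\log y_0-\mathbb{E}[Y_x]\log q .$$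
   Context: $\log$ is the natural logarithm, $h(p)=-p\log p-(1-p)\log(1-p)$, and $D_{\mathsf{KL}}$ is the Kullback–Leibler divergence (in nats). *)

(* Defs.v *)
From mathcomp Require Import all_boot all_order all_algebra.
From mathcomp Require Import all_classical all_reals all_analysis.
Set Implicit Arguments.
Unset Strict Implicit.
Unset Printing Implicit Defensive.
Import Order.TTheory GRing.Theory Num.Theory.
Import numFieldNormedType.Exports.
Local Open Scope classical_set_scope.
Local Open Scope ring_scope.

(* A distribution on the positive integers is given by its mass function
   [P : nat -> R]; the value [P 0] is never used. *)

Definition is_pmf (R : realType) (P : nat -> R) : Prop :=
  (forall y : nat, (1 <= y)%N -> 0 <= P y) /\
  (\sum_(1 <= y <oo) (P y)%:E = 1)%E.

Definition pmf_mean (R : realType) (P : nat -> R) : \bar R :=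
  (\sum_(1 <= y <oo) (y%:R * P y)%:E)%E.

(* Conventions 0 log (0 / b) = 0 and a log (a / 0) = +oo for a > 0. *)
Definition KL_term (R : realType) (a b : R) : \bar R :=
  if a == 0 then 0%E else if b == 0 then +oo%E else (a * ln (a / b))%:E.

(* The terms are signed, so the sum is the limit of the partial sums. For mass
   functions it always exists: if a, b >= 0 then KL_term a b >= a - b, so the
   negative parts are summable. *)
Definition KL (R : realType) (P Q : nat -> R) : \bar R :=
  (\sum_(1 <= y <oo) KL_term (P y) (Q y))%E.

Definition binary_entropy (R : realType) (p : R) : R :=
  - p * ln p - (1 - p) * ln (1 - p).

(* The guard is needed because subtraction on [nat] is truncated. *)
Definition Ydist (R : realType) (p : R) (x y : nat) : R :=
  if (x <= y <= 2 * x)%N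
  then 'C(x, y - x)%:R * (1 - p) ^+ (2 * x - y) * p ^+ (y - x)
  else 0.

Definition f1 (R : realType) (p : R) (y : nat) (t : R) : R :=
  (1 - t * y%:R / (1 + p)) / (t * ln (1 - t)) -
  (Num.sqrt ((1 + p) ^+ 2 - 4 * p * t) - (1 - p)) ^+ y /
    ((2 * p) ^+ y * t * ln (1 - t)).

Definition f2 (R : realType) (p : R) (y : nat) (t : R) : R :=
  (1 - t * y%:R * p / (1 + p)) / (t * ln (1 - t)) -
  (Num.sqrt ((1 + p) ^+ 2 - 4 * p ^+ 2 * t) - (1 - p)) ^+ y /
    ((2 * p) ^+ y * t * ln (1 - t)).

Definition f3 (R : realType) (p : R) (y : nat) (t : R) : R :=
  (1 - t * y%:R * (1 - p) / (1 + p)) / (t * ln (1 - t)) -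
  (Num.sqrt ((1 + p) ^+ 2 - 4 * p * (1 - p) * t) - (1 - p)) ^+ y /
    ((2 * p) ^+ y * t * ln (1 - t)).

(* The integrands are undefined at the endpoints 0 and 1, hence the open
   interval. *)
Definition integral01 (R : realType) (f : R -> R) : R :=
  \int[@lebesgue_measure R]_(t in `]0, 1[) f t.

Definition g (R : realType) (p : R) (y : nat) : R :=
  integral01 (f1 p y) - integral01 (f2 p y) - integral01 (f3 p y).

Definition Yq_weight (R : realType) (p q : R) (y : nat) : R :=
  q ^+ y * expR (g p y - y%:R * binary_entropy p / (1 + p)).

Definition Yq_sum (R : realType) (p q : R) : \bar R :=
  (\sum_(1 <= y <oo) (Yq_weight p q y)%:E)%E.

Definition y0 (R : realType) (p q : R) : R := (fine (Yq_sum p q))^-1.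

Definition Yq (R : realType) (p q : R) (y : nat) : R :=
  y0 p q * Yq_weight p q y.

(* Main.v *)
Require Import Defs.
From mathcomp Require Import all_boot all_order all_algebra.
From mathcomp Require Import all_classical all_reals all_analysis.
From mathcomp Require Import measurable_realfun zify ring lra.
Set Implicit Arguments.
Unset Strict Implicit.
Unset Printing Implicit Defensive.
Import Order.TTheory GRing.Theory Num.Theory.
Import numFieldNormedType.Exports.
Local Open Scope classical_set_scope.
Local Open Scope ring_scope.

(* Let z(s) be the nonnegative root of p z^2 + (1 - p) z = 1 - s. The integrand
   f_i(y, t) is (1 - a t y / (1 + p) - z(a t)^y) / (t log(1 - t)) with a = 1, p,
   1 - p respectively. If V is binomial (x, p), then Y_x is the law of x + V and
   its generating function (z (1 - p + p z))^x equals (1 - s)^x at z = z(s).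
   Hence E f_i(Y_x, t) = (1 - a t x - (1 - a t)^x) / (t log(1 - t)), and since
   log n! = int_0^1 (1 - t n - (1 - t)^n) / (t log(1 - t)) dt, the expectations
   of the three Lambda_i are log x!, E log V! and E log (x - V)!. So
   E g(Y_x) = E log C(x, V), which makes the divergence affine in E Y_x.

   For the convergence of the series, the linear terms in t cancel in
   M(t) = 1 + z(t)^y - z(p t)^y - z((1 - p) t)^y, and
   g(y) = int_0^1 (M(t) / t^2) r(t) dt with 1 - t <= r(t) = - t / log(1 - t) <= 1.
   The integral of M / t^2 is at most y h(p) / (1 + p), by rescaling t and z <= 1.
   Replacing r by 1 costs at most int_0^1 (1 - (1 - t)^y) / t dt, the y-th
   harmonic number, because M(t) >= z(t)^y - 1 >= (1 - t)^y - 1. Therefore the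
   weights are at most e y q^y. *)

(** * Integration over the open unit interval *)

Definition integrable01 (R : realType) (f : R -> R) : Prop :=
  (@lebesgue_measure R).-integrable `]0, 1[ (EFin \o f).

Section Integral01.
Variable R : realType.
Implicit Types (f g F : R -> R) (t : R).

Lemma measurable_itv01 : measurable ([set` `]0, 1[] : set (measurableTypeR R)).
Proof. exact: measurable_itv. Qed.

Lemma lebesgue_measure01 : (@lebesgue_measure R `]0%R, 1%R[ = 1)%E.
Proof. by rewrite lebesgue_measure_itv/= lte01 oppr0 adde0. Qed.

Lemma bounded_integrable01 f M : measurable_fun (`]0, 1[ : set R) f ->
  (forall t, 0 < t < 1 -> `|f t| <= M) -> integrable01 f.
Proof.
move=> mf fM; apply: measurable_bounded_integrable => //.
  apply: le_lt_trans (ltry 1).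
  by move/eqP: lebesgue_measure01; rewrite eq_le => /andP[].
exists M; split; first exact: num_real.
move=> N MN t /=; rewrite in_itv/= => t01.
exact: le_trans (fM t t01) (ltW MN).
Qed.

Lemma integral01_ext f g : (forall t, 0 < t < 1 -> f t = g t) ->
  integral01 f = integral01 g.
Proof.
move=> fg; apply: eq_Rintegral => t; rewrite inE/= in_itv/=; exact: fg.
Qed.

Lemma integrable01_ext f g : (forall t, 0 < t < 1 -> f t = g t) ->
  integrable01 f -> integrable01 g.
Proof.
move=> fg; apply: eq_integrable => //= t; rewrite inE/= in_itv/= => t01.
by rewrite fg.
Qed.

Lemma integral01_le f g : integrable01 f -> integrable01 g ->
  (forall t, 0 < t < 1 -> f t <= g t) -> integral01 f <= integral01 g.
Proof.
move=> intf intg fg; apply: le_Rintegral => // t /=; rewrite in_itv/=.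
Qed.

Lemma integrable01D f g : integrable01 f -> integrable01 g ->
  integrable01 (fun t => f t + g t).
Proof. by move=> intf intg; exact: (integrableD measurable_itv01 intf intg). Qed.

Lemma integrable01Z c f : integrable01 f -> integrable01 (fun t => c * f t).
Proof. by move=> intf; exact: (integrableZl measurable_itv01 c intf). Qed.

Lemma integrable01B f g : integrable01 f -> integrable01 g ->
  integrable01 (fun t => f t - g t).
Proof. by move=> intf intg; exact: (integrableB measurable_itv01 intf intg). Qed.

Lemma integral01D f g : integrable01 f -> integrable01 g ->
  integral01 (fun t => f t + g t) = integral01 f + integral01 g.
Proof. by move=> intf intg; exact: RintegralD. Qed.

Lemma integral01B f g : integrable01 f -> integrable01 g ->
  integral01 (fun t => f t - g t) = integral01 f - integral01 g.
Proof. by move=> intf intg; exact: RintegralB. Qed.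

Lemma integral01Z c f : integrable01 f ->
  integral01 (fun t => c * f t) = c * integral01 f.
Proof. by move=> intf; exact: RintegralZl. Qed.

Lemma integrable01_0 : integrable01 (fun=> 0 : R).
Proof. exact: integrable0. Qed.

Lemma integral01_0 : integral01 (fun=> 0 : R) = 0.
Proof. by rewrite /integral01 Rintegral_cst// mul0r. Qed.

Lemma integrable01_sum (I : Type) (s : seq I) (c : I -> R) (f : I -> R -> R) :
  (forall i, integrable01 (f i)) ->
  integrable01 (fun t => \sum_(i <- s) c i * f i t).
Proof.
move=> intf; elim: s => [|i s IHs].
  by apply: integrable01_ext integrable01_0 => t _; rewrite big_nil.
apply: integrable01_ext (integrable01D (integrable01Z (c i) (intf i)) IHs).
by move=> t _; rewrite big_cons.
Qed.

Lemma integral01_sum (I : Type) (s : seq I) (c : I -> R) (f : I -> R -> R) :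
  (forall i, integrable01 (f i)) ->
  integral01 (fun t => \sum_(i <- s) c i * f i t) =
  \sum_(i <- s) c i * integral01 (f i).
Proof.
move=> intf; elim: s => [|i s IHs].
  rewrite big_nil -[RHS]integral01_0; apply: integral01_ext => t _.
  by rewrite big_nil.
rewrite big_cons -IHs -integral01Z// -integral01D//.
- by apply: integral01_ext => t _; rewrite big_cons.
- exact: integrable01Z.
- exact: integrable01_sum.
Qed.

Lemma continuous01_integrable f : {within `[0, 1], continuous f} ->
  integrable01 f.
Proof.
move=> cf.
apply: (@integrableS _ _ _ _ ([set` `[0, 1]] : set (measurableTypeR R))).
- exact: measurable_itv.
- exact: measurable_itv.
- exact: subset_itv_oo_cc.
- by apply: continuous_compact_integrable => //; exact: segment_compact.
Qed.

(** The endpoints are null, so the closed interval may be used. One-sided limits of [F] at the ends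
    suit real powers of 1 - t, which are meaningful only up to t = 1. *)
Lemma integral01_FTC2 f F : {within `[0, 1], continuous f} ->
  (forall t, 0 < t < 1 -> is_derive t 1 F (f t)) ->
  F x @[x --> 0^'+] --> F 0 -> F x @[x --> 1^'-] --> F 1 ->
  integral01 f = F 1 - F 0.
Proof.
move=> cf dF F0 F1.
have e : integral01 f = \int[@lebesgue_measure R]_(t in `[0, 1]) f t.
  have i2 : (@lebesgue_measure R).-integrable `[0, 1] (EFin \o f).
    by apply: continuous_compact_integrable => //; exact: segment_compact.
  rewrite /integral01 Rintegral_itv_bndo_bndc; last first.
    exact: continuous01_integrable.
  rewrite Rintegral_itv_obnd_cbnd//.
  apply: (integrableS _ _ _ i2); [exact: measurable_itv|exact: measurable_itv|].
  by apply: subset_itv; rewrite bnd_simp.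
rewrite e /Rintegral (@continuous_FTC2 _ f F)//.
  split=> // t; rewrite in_itv/= => t01.
  by have [] := dF t t01.
move=> t; rewrite in_itv/= => t01; rewrite derive1E.
by have [] := dF t t01.
Qed.

End Integral01.

(** * Real powers of 1 - t and their integrals *)

Section LogFactorial.
Variable R : realType.
Implicit Types (s h t : R) (f : R -> R).

Lemma continuous_oo_measurable01 f :
  (forall t, 0 < t < 1 -> {for t, continuous f}) ->
  measurable_fun (`]0, 1[ : set R) f.
Proof.
move=> cf; apply: open_continuous_measurable_fun; first exact: interval_open.
by move=> t; rewrite inE/= in_itv/=; exact: cf.
Qed.

Lemma cvg_onem_powR_at1 s : 0 < s -> (1 - x) `^ s @[x --> (1 : R)^'-] --> (0 : R).
Proof.
move=> s0.
have onem_cvg : (1 - x) @[x --> (1 : R)^'-] --> (0 : R)^'+.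
  move=> A; rewrite /at_right /at_left /= !near_simpl /within /= => A0.
  have c : (1 - x) @[x --> (1 : R)] --> (1 - 1 : R).
    by apply: cvgB; [exact: cvg_cst|exact: cvg_id].
  rewrite subrr in c.
  have {}c : nbhs (1 : R) [set x | 0 < 1 - x -> A (1 - x)] := c _ A0.
  suff : nbhs (1 : R) [set x | x < 1 -> A (1 - x)] by [].
  by apply: filterS c => x /= + x1; apply; rewrite subr_gt0.
exact: (cvg_comp _ _ onem_cvg (powR_cvg0 s0)).
Qed.

Lemma is_derive_onem_powR s t : t < 1 ->
  is_derive t 1 (fun x => (1 - x) `^ s) (- (s * (1 - t) `^ (s - 1))).
Proof.
move=> t1.
have t10 : 0 < 1 - t by rewrite subr_gt0.
have h1 := @is_derive1_powR R s (1 - t) t10.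
have h2 : is_derive t 1 (fun x : R => 1 - x) (-1).
  have := is_deriveB (is_derive_cst (1 : R) t 1) (is_derive_id t (1 : R)).
  by rewrite sub0r.
have := is_derive1_comp (g := fun x : R => 1 - x) h1 h2.
by rewrite mulrN1.
Qed.

Lemma cvg_onem_powR_at0 s : (1 - x) `^ s @[x --> (0 : R)^'+] --> (1 - 0 : R) `^ s.
Proof.
have [+ _] := is_derive_onem_powR s (ltr01 : (0 : R) < 1).
move=> /derivable1_diffP/differentiable_continuous.
exact: cvg_at_right_filter.
Qed.

(** The case s = 0 is separate because 0 to the power 0 is 1, while for s > 0 the value at t = 1 is
    0, the left limit there. *)
Lemma within_continuous_onem_powR s : 0 <= s ->
  {within `[0, 1], continuous (fun x : R => (1 - x) `^ s)}.
Proof.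
rewrite le_eqVlt => /predU1P[<-|s0].
  have -> : (fun x : R => (1 - x) `^ 0) = cst 1.
    by apply/funext => x; rewrite powRr0.
  by move=> x; exact: cvg_cst.
apply: derivable_oo_LRcontinuous_within; split.
- move=> t; rewrite in_itv/= => /andP[_ t1].
  by have [] := is_derive_onem_powR s t1.
- exact: cvg_onem_powR_at0.
- by rewrite subrr powR0 ?gt_eqF//; exact: cvg_onem_powR_at1.
Qed.

Lemma integrable01_onem_powR s : 0 <= s ->
  integrable01 (fun t : R => (1 - t) `^ s).
Proof.
by move=> s0; apply: continuous01_integrable; exact: within_continuous_onem_powR.
Qed.

Lemma integral01_onem_powR s : 0 <= s ->
  integral01 (fun t : R => (1 - t) `^ s) = (1 + s)^-1.
Proof.
move=> s0; have s1 : 0 < 1 + s by rewrite ltr_wpDr.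
pose F t := - (1 + s)^-1 * (1 - t) `^ (1 + s).
have -> : (1 + s)^-1 = F 1 - F 0.
  by rewrite /F subrr subr0 powR0 ?gt_eqF// powR1; ring.
apply: integral01_FTC2.
- exact: within_continuous_onem_powR.
- move=> t /andP[_ t1].
  have h := is_deriveZ (- (1 + s)^-1) (is_derive_onem_powR (1 + s) t1).
  apply: (is_derive_eq h).
  rewrite (addrC 1 s) addrK /GRing.scale/=.
  by field; rewrite addrC gt_eqF.
- by apply: cvgM; [exact: cvg_cst|exact: cvg_onem_powR_at0].
- apply: cvgM; first exact: cvg_cst.
  by rewrite subrr powR0 ?gt_eqF//; exact: cvg_onem_powR_at1.
Qed.

End LogFactorial.

(** * Integral representations of ln (1 + s) and of the log-factorial *)

Section LogKernel.
Variable R : realType.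
Implicit Types (s h t : R) (f : R -> R).

(** Under t = 1 - exp (- u) this becomes the Frullani integrand (exp (- u) - exp (- (1 + s) u)) / u,
    whose integral is ln (1 + s). *)
Definition log_kernel s t := (1 - (1 - t) `^ s) / - ln (1 - t).

Lemma ln_onem_lt0 t : 0 < t < 1 -> 0 < - ln (1 - t).
Proof. by move=> /andP[t0 t1]; rewrite oppr_gt0 ln_lt0//; lra. Qed.

Lemma onem_powRE s t : t < 1 -> (1 - t) `^ s = expR (s * ln (1 - t)).
Proof. by move=> t1; rewrite /powR; case: eqP => // h; lra. Qed.

(** Convexity: exp x >= 1 + x is used at a - b and at b - a, then rescaled. *)
Lemma expR_secant (a b : R) : (a - b) * expR b <= expR a - expR b <= (a - b) * expR a.
Proof.
have ha := expR_ge1Dx (a - b); have hb := expR_ge1Dx (b - a).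
have ea : expR a = expR (a - b) * expR b by rewrite -expRD subrK.
have eb : expR b = expR (b - a) * expR a by rewrite -expRD subrK.
have := expR_ge0 a; have := expR_ge0 b => b0 a0.
have := ler_wpM2r b0 ha; have := ler_wpM2r a0 hb; rewrite -ea -eb.
by move=> h1 h2; apply/andP; split; lra.
Qed.

(** The secant bound between the exponents s L and (s + h) L, with L = ln (1 - t): their difference
    is h (- L), and the denominator cancels - L. *)
Lemma log_kernel_incr s h t : 0 < t < 1 ->
  h * (1 - t) `^ (s + h) <= log_kernel (s + h) t - log_kernel s t
    <= h * (1 - t) `^ s.
Proof.
move=> t01; have L0 := ln_onem_lt0 t01; have t1 : t < 1 by case/andP: t01.
rewrite /log_kernel !onem_powRE// -mulrBl ler_pdivrMr// ler_pdivlMr//.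
have := expR_secant (s * ln (1 - t)) ((s + h) * ln (1 - t)).
set a := expR (s * _); set b := expR (_ * _) => hab; apply/andP; lra.
Qed.

Lemma log_kernel0 t : log_kernel 0 t = 0.
Proof. by rewrite /log_kernel powRr0 subrr mul0r. Qed.

Lemma continuous_ln_onem t : t < 1 -> {for t, continuous (fun x : R => ln (1 - x))}.
Proof.
move=> t1; apply: (@continuous_comp _ _ _ (fun x : R => 1 - x) (@ln R)).
  by apply: cvgB; [exact: cvg_cst|exact: cvg_id].
by apply: continuous_ln; rewrite subr_gt0.
Qed.

Lemma continuous_onem_powR s t : t < 1 ->
  {for t, continuous (fun x : R => (1 - x) `^ s)}.
Proof.
move=> t1; have [+ _] := is_derive_onem_powR s t1.
by move=> /derivable1_diffP/differentiable_continuous.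
Qed.

Lemma integrable01_log_kernel s : 0 <= s -> integrable01 (log_kernel s).
Proof.
move=> s0; apply: (@bounded_integrable01 _ _ s).
  apply: continuous_oo_measurable01 => t t01; have /andP[_ t1] := t01.
  apply: cvgM.
    by apply: cvgB; [exact: cvg_cst|exact: continuous_onem_powR].
  apply: cvgV; first by rewrite gt_eqF// ln_onem_lt0.
  by apply: cvgN; exact: continuous_ln_onem.
move=> t t01; have /andP[] := log_kernel_incr 0 s t01.
rewrite add0r log_kernel0 subr0 powRr0 mulr1 => h1 h2.
by rewrite ger0_norm// (le_trans _ h1)// mulr_ge0// powR_ge0.
Qed.

(** Both bounds come from ln (1 + u) <= u, applied to the ratio of the two arguments and to its
    inverse. *)
Lemma ln_increment (a h : R) : 0 < a -> 0 <= h ->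
  h / (a + h) <= ln (a + h) - ln a <= h / a.
Proof.
move=> a0 h0; have ah0 : 0 < a + h by lra.
have aux (x y : R) : 0 < x -> 0 < y -> ln x - ln y <= (x - y) / y.
  move=> x0 y0; rewrite -ln_div// -[X in ln X](subrKC 1).
  have xy : 0 < x / y by rewrite divr_gt0.
  have -> : (x - y) / y = x / y - 1 by field; rewrite gt_eqF.
  by apply: le_ln1Dx; lra.
apply/andP; split; last first.
  by apply: le_trans (aux _ _ ah0 a0) _; rewrite addrAC subrr add0r.
have := aux _ _ a0 ah0.
have -> : (a - (a + h)) / (a + h) = - (h / (a + h)) by field; rewrite gt_eqF.
lra.
Qed.

Lemma integral01_log_kernel_incr s h : 0 <= s -> 0 <= h ->
  h / (1 + s + h) <= integral01 (log_kernel (s + h)) - integral01 (log_kernel s)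
    <= h / (1 + s).
Proof.
move=> s0 h0; have sh0 : 0 <= s + h by lra.
have ik := integrable01_log_kernel sh0; have iks := integrable01_log_kernel s0.
have ipsh := integrable01_onem_powR sh0; have ips := integrable01_onem_powR s0.
rewrite -integral01B// -addrA -!integral01_onem_powR// -!integral01Z//.
apply/andP; split; apply: integral01_le;
  do ?[exact: integrable01Z|exact: integrable01B].
- by move=> t /(log_kernel_incr s h)/andP[].
- by move=> t /(log_kernel_incr s h)/andP[].
Qed.

Lemma inv_increment_le (a h : R) : 1 <= a -> 0 <= h ->
  h / a - h / (a + h) <= h ^+ 2.
Proof.
move=> a1 h0; have a0 : 0 < a := lt_le_trans ltr01 a1.
have ah0 : 0 < a + h by rewrite ltr_wpDr.
have -> : h / a - h / (a + h) = h ^+ 2 / (a * (a + h)).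
  by field; rewrite !gt_eqF.
rewrite ler_pdivrMr ?mulr_gt0// ler_peMr ?sqr_ge0//.
by rewrite mulr_ege1// ler_wpDr.
Qed.

(* Both sides have increments between [h / (1 + s + h)] and [h / (1 + s)], so
   their difference changes by at most [h ^+ 2] over a step [h]; cutting [0, s]
   into [m] steps bounds it by [s ^+ 2 / m]. *)
Lemma integral01_log_kernel s : 0 <= s -> integral01 (log_kernel s) = ln (1 + s).
Proof.
move=> s0; apply/eqP; rewrite -subr_eq0 -normr_eq0; apply/negPn/negP => d0.
pose D x := integral01 (log_kernel x) - ln (1 + x).
have D0 : D 0 = 0.
  rewrite /D addr0 ln1 subr0 -[RHS](@integral01_0 R).
  by apply: integral01_ext => t _; rewrite log_kernel0.
have Dh x h : 0 <= x -> 0 <= h -> `|D (x + h) - D x| <= h ^+ 2.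
  move=> x0 h0; have x10 : 0 < 1 + x by lra.
  have h1 := integral01_log_kernel_incr x0 h0.
  have h2 := ln_increment x10 h0.
  have h3 := inv_increment_le (_ : 1 <= 1 + x) h0.
  have {}h3 := h3 (ler_wpDr x0 (lexx 1)).
  rewrite ler_norml /D addrA; move: h1 h2 h3.
  move: (h / (1 + x)) (h / (1 + x + h)) (integral01 _) (integral01 _).
  move: (ln _) (ln _) (h ^+ 2) => l l' hh b a k k' /andP[? ?] /andP[? ?] ?.
  by apply/andP; split; lra.
have Dn h n : 0 <= h -> `|D (n%:R * h)| <= n%:R * h ^+ 2.
  move=> h0; elim: n => [|n IHn]; first by rewrite !mul0r D0 normr0.
  have -> : n.+1%:R * h = n%:R * h + h by rewrite -natr1 mulrDl mul1r.
  have := Dh (n%:R * h) h (mulr_ge0 (ler0n _ _) h0) h0.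
  have := ler_normD (D (n%:R * h)) (D (n%:R * h + h) - D (n%:R * h)).
  rewrite addrC subrK -natr1 mulrDl mul1r; lra.
have dpos : 0 < `|D s| by rewrite lt_neqAle eq_sym d0 normr_ge0.
(* With m > s^2 / |D s|, the bound s^2 / m falls below |D s|, a contradiction. *)
have := archi_boundP (divr_ge0 (sqr_ge0 s) (ltW dpos)).
set m := Num.bound _ => hm.
have m0 : 0 < m%:R :> R by apply: le_lt_trans hm; rewrite divr_ge0// sqr_ge0.
have := Dn (s / m%:R) m (divr_ge0 s0 (ltW m0)).
have -> : m%:R * (s / m%:R) = s by field; rewrite gt_eqF.
have -> : m%:R * (s / m%:R) ^+ 2 = s ^+ 2 / m%:R by field; rewrite gt_eqF.
by rewrite ler_pdivlMr// leNgt mulrC -ltr_pdivrMr// hm.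
Qed.

Definition log_fact_kernel (v : nat) t :=
  (1 - t * v%:R - (1 - t) ^+ v) / (t * ln (1 - t)).

(** Passing from v to v + 1 adds exactly [log_kernel v%:R t], which mirrors ln v! being the sum of
    ln (1 + j) over j < v. The factor 1 fits the form of [integral01_sum]. *)
Lemma log_fact_kernelE (v : nat) t : 0 < t < 1 ->
  log_fact_kernel v t = \sum_(0 <= j < v) 1 * log_kernel j%:R t.
Proof.
move=> t01; have L0 := ln_onem_lt0 t01; case/andP: t01 => t0 t1.
have nz : (t != 0) && (ln (1 - t) != 0).
  by rewrite gt_eqF//= -oppr_eq0 gt_eqF.
elim: v => [|v IHv].
  by rewrite big_nil /log_fact_kernel mulr0 subr0 expr0 subrr mul0r.
rewrite big_nat_recr//= -IHv mul1r /log_kernel powR_mulrn ?subr_ge0 1?ltW//.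
rewrite /log_fact_kernel -natr1 exprS; field.
by case/andP: nz => -> ->.
Qed.

Lemma integrable01_log_fact_kernel v : integrable01 (log_fact_kernel v).
Proof.
apply: (@integrable01_ext _ (fun t => \sum_(0 <= j < v) 1 * log_kernel j%:R t)).
  by move=> t t01; rewrite log_fact_kernelE.
by apply: integrable01_sum => j; exact: integrable01_log_kernel.
Qed.

Lemma integral01_log_fact_kernel v : integral01 (log_fact_kernel v) = ln v`!%:R.
Proof.
rewrite (integral01_ext (@log_fact_kernelE v)) integral01_sum; last first.
  by move=> j; exact: integrable01_log_kernel.
elim: v => [|v IHv]; first by rewrite big_nil fact0 ln1.
rewrite big_nat_recr//= IHv mul1r integral01_log_kernel// nat1r factS natrM.
by rewrite lnM ?posrE ?ltr0n ?fact_gt0// addrC.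
Qed.

End LogKernel.

(** * The root z(s) and regularity of the integrands *)

Section Root.
Variables (R : realType) (p : R).
Hypothesis hp : 0 < p < 1.
Implicit Types (s t a : R) (y : nat).

(* The nonnegative root [z] of [p z^2 + (1 - p) z = 1 - s]. *)
Definition zroot s : R := (Num.sqrt ((1 + p) ^+ 2 - 4 * p * s) - (1 - p)) / (2 * p).

Lemma param_gt0 : 0 < p. Proof. by case/andP: hp. Qed.
Lemma param_lt1 : p < 1. Proof. by case/andP: hp. Qed.

Lemma zroot_sqrt s : 2 * p * zroot s + (1 - p) = Num.sqrt ((1 + p) ^+ 2 - 4 * p * s).
Proof. by rewrite /zroot mulrC divfK ?subrK// gt_eqF// mulr_gt0// param_gt0. Qed.

Lemma zroot_eq s : s <= 1 -> zroot s * (1 - p + p * zroot s) = 1 - s.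
Proof.
move=> s1; have d0 : 0 <= (1 + p) ^+ 2 - 4 * p * s.
  have -> : (1 + p) ^+ 2 - 4 * p * s = (1 - p) ^+ 2 + 4 * p * (1 - s) by ring.
  by rewrite addr_ge0 ?sqr_ge0// !mulr_ge0 ?subr_ge0// ltW ?param_gt0.
have := sqr_sqrtr d0; rewrite -zroot_sqrt; set z := zroot s => h.
have p4 : 4 * p != 0 by rewrite gt_eqF// mulr_gt0// param_gt0.
apply: (mulfI p4).
have -> : 4 * p * (z * (1 - p + p * z)) = (2 * p * z + (1 - p)) ^+ 2 - (1 - p) ^+ 2.
  by ring.
by rewrite h; ring.
Qed.

(** The quadratic has the root z = 1 at s = 0; this form shows that 1 - z is of order s. *)
Lemma zroot_factor s : s <= 1 -> s = (1 - zroot s) * (1 + p * zroot s).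
Proof. by move=> /zroot_eq; lra. Qed.

(** A square root is nonnegative, so 2 p z >= p - 1 and 2 (1 + p z) >= 1 + p. *)
Lemma zroot_den_gt0 s : 0 < 1 + p * zroot s.
Proof.
have := sqrtr_ge0 ((1 + p) ^+ 2 - 4 * p * s); rewrite -zroot_sqrt.
by have := param_gt0; lra.
Qed.

Lemma zroot_ge0 s : s <= 1 -> 0 <= zroot s.
Proof.
move=> s1; have h := zroot_eq s1.
have := sqrtr_ge0 ((1 + p) ^+ 2 - 4 * p * s); rewrite -zroot_sqrt => h2.
rewrite leNgt; apply/negP => z0; have := param_gt0; have := param_lt1; nra.
Qed.

Lemma zroot_le1 s : 0 <= s <= 1 -> zroot s <= 1.
Proof.
move=> /andP[s0 s1]; have h := zroot_factor s1; have := zroot_den_gt0 s.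
rewrite leNgt => h2; apply/negP => z0; have := param_gt0; have := param_lt1; nra.
Qed.

(** In 1 - s = z (1 - p + p z) the second factor is at most 1, because z <= 1. *)
Lemma zroot_ge_onem s : 0 <= s <= 1 -> 1 - s <= zroot s.
Proof.
move=> s01; have z1 := zroot_le1 s01; case/andP: s01 => s0 s1.
have z0 := zroot_ge0 s1; rewrite -zroot_eq//; have := param_gt0 => ?.
by rewrite ler_piMr//; nra.
Qed.

Lemma continuous_zroot : continuous zroot.
Proof.
move=> s; apply: cvgM; last exact: cvg_cst.
apply: cvgB; last exact: cvg_cst.
apply: (@continuous_comp _ _ _ (fun s => (1 + p) ^+ 2 - 4 * p * s) Num.sqrt).
  apply: cvgB; first exact: cvg_cst.
  by apply: cvgM; [exact: cvg_cst|exact: cvg_id].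
exact: sqrt_continuous.
Qed.

(** Taylor expansion at z = 1 with an explicit polynomial remainder, from two uses of the geometric
    sum. *)
Lemma expr_second_order (z : R) y :
  z ^+ y = 1 - y%:R * (1 - z) +
    (1 - z) ^+ 2 * \sum_(0 <= j < y) \sum_(0 <= i < j) z ^+ i.
Proof.
have geom n : (1 - z) * \sum_(0 <= i < n) z ^+ i = 1 - z ^+ n.
  elim: n => [|n IHn]; first by rewrite big_nil mulr0 subrr.
  by rewrite big_nat_recr//= mulrDr IHn exprS; ring.
elim: y => [|n IHn]; first by rewrite big_nil mulr0 mul0r subr0 addr0.
rewrite big_nat_recr//= -natr1 exprS.
move: (geom n) IHn; set T := \sum_(0 <= i < n) z ^+ i; set S := \sum_(0 <= j < n) _.
move=> gn IHn; have -> : (1 - z) ^+ 2 * (S + T) =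
    (1 - z) ^+ 2 * S + (1 - z) * ((1 - z) * T) by ring.
by rewrite gn; move: (z ^+ n) IHn => zn ->; ring.
Qed.

(* [(z ^+ y - 1 + s y / (1 + p)) / s ^+ 2] at [z = zroot s], with the factor
   [(1 - z) ^+ 2] cancelled so that it is continuous at [s = 0]. *)
Definition second_diff y s : R :=
  (\sum_(0 <= j < y) \sum_(0 <= i < j) zroot s ^+ i - y%:R / (1 + p) * p) /
  (1 + p * zroot s) ^+ 2.

(** Substituting s = (1 - z) (1 + p z), the first-order terms - y (1 - z) + s y / (1 + p) reduce to
    - y p (1 - z)^2 / (1 + p), which accounts for the correction in [second_diff]. *)
Lemma second_diffE y s : s <= 1 ->
  s ^+ 2 * second_diff y s = zroot s ^+ y - 1 + s * y%:R / (1 + p).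
Proof.
move=> s1; rewrite (expr_second_order (zroot s)) /second_diff.
have := zroot_factor s1; have := zroot_den_gt0 s.
set z := zroot s; set S := \sum_(0 <= j < y) _ => d0 sE.
have := param_gt0; rewrite [in LHS]sE [in RHS]sE => ?; field.
by rewrite !gt_eqF//; lra.
Qed.

Lemma continuous_sum_nat (f : nat -> R -> R) n : (forall i, continuous (f i)) ->
  continuous (fun s => \sum_(0 <= i < n) f i s).
Proof.
move=> cf; elim: n => [|n IHn].
  have -> : (fun s => \sum_(0 <= i < 0) f i s) = cst 0.
    by apply/funext => s; rewrite big_nil.
  by move=> s; exact: cvg_cst.
have -> : (fun s => \sum_(0 <= i < n.+1) f i s) =
    (fun s => \sum_(0 <= i < n) f i s + f n s).
  by apply/funext => s; rewrite big_nat_recr.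
by move=> s; apply: cvgD; [exact: IHn|exact: cf].
Qed.

Lemma continuous_second_diff y : continuous (second_diff y).
Proof.
move=> s; apply: cvgM.
  apply: cvgB; last exact: cvg_cst.
  apply: continuous_sum_nat => j {}s; apply: continuous_sum_nat => i {}s.
  apply: (@continuous_comp _ _ _ zroot (fun z => z ^+ i)).
    exact: continuous_zroot.
  exact: exprn_continuous.
apply: cvgV; first by rewrite expf_neq0// gt_eqF// zroot_den_gt0.
apply: (@continuous_comp _ _ _ (fun s => 1 + p * zroot s) (fun z => z ^+ 2)).
  apply: cvgD; first exact: cvg_cst.
  by apply: cvgM; [exact: cvg_cst|exact: continuous_zroot].
exact: exprn_continuous.
Qed.

(** The factor r(t) of the overview. *)
Definition log_ratio t : R := t / - ln (1 - t).

Lemma log_ratio_bounds t : 0 < t < 1 -> 1 - t <= log_ratio t <= 1.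
Proof.
move=> t01; have L0 := ln_onem_lt0 t01; case/andP: t01 => t0 t1.
have t10 : 0 < 1 - t by lra.
have := ln_increment t10 (ltW t0); rewrite subrK ln1 sub0r divr1.
rewrite (ler_pdivlMr _ _ t10) => /andP[h1 h2].
by rewrite /log_ratio ler_pdivlMr// ler_pdivrMr// mul1r h1 mulrC h2.
Qed.

(** Common form of [f1], [f2] and [f3], which are the cases a = 1, p and 1 - p. *)
Definition kernelf a y t : R :=
  (1 - a * t * y%:R / (1 + p) - zroot (a * t) ^+ y) / (t * ln (1 - t)).

Lemma kernelfE a y t : 0 <= a <= 1 -> 0 < t < 1 ->
  kernelf a y t = a ^+ 2 * second_diff y (a * t) * log_ratio t.
Proof.
move=> /andP[a0 a1] t01; have L0 := ln_onem_lt0 t01; case/andP: t01 => t0 t1.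
have at1 : a * t <= 1 by nra.
have := second_diffE y at1; rewrite /kernelf /log_ratio.
set n := second_diff _ _; set zy := zroot _ ^+ y => h.
have -> : 1 - a * t * y%:R / (1 + p) - zy = - ((a * t) ^+ 2 * n) by lra.
have tn : t != 0 by rewrite gt_eqF.
have Ln : ln (1 - t) != 0 by rewrite -oppr_eq0 gt_eqF.
by field; rewrite Ln tn.
Qed.

(** The point a t stays in [0, 1], where the continuous function |[second_diff]| attains a maximum,
    so the product is bounded. *)
Lemma integrable01_second_diff y a (f : R -> R) : 0 <= a <= 1 ->
  (forall t, 0 < t < 1 -> {for t, continuous f}) ->
  (forall t, 0 < t < 1 -> `|f t| <= 1) ->
  integrable01 (fun t => second_diff y (a * t) * f t).
Proof.
move=> /andP[a0 a1] cf fb.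
have c : {within `[0, 1], continuous (fun s => `|second_diff y s|)}.
  apply: continuous_subspaceT => s.
  apply: (@continuous_comp _ _ _ (second_diff y) Num.norm).
    exact: continuous_second_diff.
  exact: norm_continuous.
have [M _ hM] := EVT_max ler01 c.
apply: (@bounded_integrable01 _ _ `|second_diff y M|).
  apply: continuous_oo_measurable01 => t t01; apply: cvgM; last exact: cf.
  apply: (@continuous_comp _ _ _ (fun t => a * t) (second_diff y)).
    by apply: cvgM; [exact: cvg_cst|exact: cvg_id].
  exact: continuous_second_diff.
move=> t t01; rewrite normrM -[leRHS]mulr1 ler_pM//; last exact: fb.
by case/andP: t01 => t0 t1; apply: hM; rewrite in_itv/=; apply/andP; split; nra.
Qed.

Lemma continuous_log_ratio t : 0 < t < 1 -> {for t, continuous log_ratio}.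
Proof.
move=> t01; have /andP[_ t1] := t01; apply: cvgM; first exact: cvg_id.
apply: cvgV; first by rewrite gt_eqF// ln_onem_lt0.
by apply: cvgN; exact: continuous_ln_onem.
Qed.

Lemma integrable01_kernelf a y : 0 <= a <= 1 -> integrable01 (kernelf a y).
Proof.
move=> a01.
apply: (@integrable01_ext _
  (fun t => a ^+ 2 * (second_diff y (a * t) * log_ratio t))).
  by move=> t t01; rewrite kernelfE// mulrA.
apply: integrable01Z; apply: integrable01_second_diff => // [t|t t01].
  exact: continuous_log_ratio.
have /andP[h1 h2] := log_ratio_bounds t01; case/andP: t01 => t0 t1.
by rewrite ger0_norm//; lra.
Qed.

Lemma f1E y t : f1 p y t = kernelf 1 y t.
Proof.
rewrite /f1 /kernelf /zroot !mul1r expr_div_n.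
rewrite [in RHS]mulrBl -[((2 * p) ^+ y * t * _)]mulrA.
by rewrite [((2 * p) ^+ y * _)^-1]invfM mulrA.
Qed.

Lemma f2E y t : f2 p y t = kernelf p y t.
Proof.
rewrite /f2 /kernelf /zroot expr_div_n.
have -> : 4 * p * (p * t) = 4 * p ^+ 2 * t by ring.
have -> : t * y%:R * p = p * t * y%:R by ring.
rewrite [in RHS]mulrBl -[((2 * p) ^+ y * t * _)]mulrA.
by rewrite [((2 * p) ^+ y * _)^-1]invfM mulrA.
Qed.

Lemma f3E y t : f3 p y t = kernelf (1 - p) y t.
Proof.
rewrite /f3 /kernelf /zroot expr_div_n.
have -> : 4 * p * ((1 - p) * t) = 4 * p * (1 - p) * t by ring.
have -> : t * y%:R * (1 - p) = (1 - p) * t * y%:R by ring.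
rewrite [in RHS]mulrBl -[((2 * p) ^+ y * t * _)]mulrA.
by rewrite [((2 * p) ^+ y * _)^-1]invfM mulrA.
Qed.

Lemma gE y : g p y = integral01 (kernelf 1 y) - integral01 (kernelf p y)
  - integral01 (kernelf (1 - p) y).
Proof.
by rewrite /g; congr (_ - _ - _); apply: integral01_ext => t _;
  rewrite ?f1E ?f2E ?f3E.
Qed.

End Root.

(** * Binomial expectations and the divergence *)

Section BinomialMean.
Variables (R : realType) (p : R).
Hypothesis hp : 0 < p < 1.
Implicit Types (s t a : R) (x y v : nat).

Definition binom_mass x v : R := 'C(x, v)%:R * (1 - p) ^+ (x - v) * p ^+ v.

Definition binom_mean x (F : nat -> R) : R := \sum_(0 <= v < x.+1) binom_mass x v * F v.

Lemma binom_mean_ext x (F G : nat -> R) : (forall v, (v <= x)%N -> F v = G v) ->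
  binom_mean x F = binom_mean x G.
Proof.
move=> FG; apply: eq_big_nat => v /andP[_]; rewrite ltnS => vx.
by rewrite FG.
Qed.

Lemma binom_meanD x (F G : nat -> R) :
  binom_mean x (fun v => F v + G v) = binom_mean x F + binom_mean x G.
Proof. by rewrite -big_split; apply: eq_bigr => v _; rewrite /= mulrDr. Qed.

Lemma binom_meanZ x c (F : nat -> R) :
  binom_mean x (fun v => c * F v) = c * binom_mean x F.
Proof. by rewrite [RHS]mulr_sumr; apply: eq_bigr => v _; rewrite mulrCA. Qed.

(** The binomial theorem as a generating function in two variables, so that powers of both V and x -
    V are covered. *)
Lemma binom_mean_exp x a b :
  binom_mean x (fun v => a ^+ (x - v) * b ^+ v) = ((1 - p) * a + p * b) ^+ x.
Proof.
rewrite exprDn /binom_mean big_mkord; apply: eq_bigr => v _.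
rewrite /binom_mass !exprMn -mulr_natl; ring.
Qed.

Lemma binom_mean_cst x c : binom_mean x (fun=> c) = c.
Proof.
have := binom_mean_exp x 1 1; rewrite !mulr1 subrK expr1n => h.
rewrite -[RHS]mulr1 -h -binom_meanZ; apply: binom_mean_ext => v _.
by rewrite !expr1n !mulr1.
Qed.

(** Absorption, (v + 1) C(x + 1, v + 1) = (x + 1) C(x, v), reduces the mean to the total mass for
    one trial fewer. *)
Lemma binom_mean_id x : binom_mean x (fun v => v%:R) = x%:R * p.
Proof.
case: x => [|x]; first by rewrite /binom_mean big_nat1 mulr0 mul0r.
rewrite /binom_mean big_nat_recl//= mulr0 add0r.
rewrite -[X in X * p](mulr1 _) -[X in _ * X * p](binom_mean_cst x 1).
rewrite -mulrA mulr_suml mulr_sumr; apply: eq_big_nat => v /andP[_ vx].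
rewrite /binom_mass subSS exprS.
have := mul_bin_diag x.+1 v; move=> /(congr1 (fun n => n%:R : R)).
rewrite !natrM; move: (_ ^+ (x - v)) (p ^+ v) => A B h.
transitivity (v.+1%:R * 'C(x.+1, v.+1)%:R * A * B * p); first by ring.
by rewrite -h; ring.
Qed.

Lemma integral01_binom_mean x (f : nat -> R -> R) :
  (forall v, integrable01 (f v)) ->
  integral01 (fun t => binom_mean x (fun v => f v t)) =
  binom_mean x (fun v => integral01 (f v)).
Proof. by move=> intf; exact: integral01_sum. Qed.

Let p0 : 0 < p := param_gt0 hp.
Let p1 : p < 1 := param_lt1 hp.

(* [z (1 - p + p z)] being [1 - s] at [z = zroot p s], the probability
   generating function of [x + V] collapses to [(1 - s) ^+ x]. *)
Lemma binom_mean_kernelf x a t : 0 <= a <= 1 -> 0 < t < 1 ->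
  binom_mean x (fun v => kernelf p a (x + v) t) =
  (1 - a * t * x%:R - (1 - a * t) ^+ x) / (t * ln (1 - t)).
Proof.
move=> /andP[a0 a1] /andP[t0 t1].
have at1 : a * t <= 1 by nra.
have p10 : 1 + p != 0 by rewrite gt_eqF// addr_gt0// p0.
pose z := zroot p (a * t).
transitivity (binom_mean x (fun v => (t * ln (1 - t))^-1 *
  (1 + (- (a * t / (1 + p)) * (x%:R + v%:R) + (- z ^+ x) * (1 ^+ (x - v) * z ^+ v))))).
  apply: binom_mean_ext => v _; rewrite /kernelf -/z natrD exprD expr1n; ring.
rewrite binom_meanZ binom_meanD binom_meanD binom_meanZ binom_meanZ binom_meanD.
rewrite !binom_mean_cst binom_mean_id binom_mean_exp [(- z ^+ x) * _]mulNr.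
rewrite -[z ^+ x * _]exprMn.
have -> : z * ((1 - p) * 1 + p * z) = 1 - a * t.
  by rewrite mulr1; exact: (zroot_eq hp at1).
rewrite [RHS]mulrC; congr (_ * _); move: (_ ^+ x) => A.
by field.
Qed.

(** Exchanges the finite expectation with the integral on both sides. [F] will be x, v or x - v,
    according to a. *)
Lemma binom_mean_integral_kernelf x a (F : nat -> nat -> nat) : 0 <= a <= 1 ->
  (forall t, 0 < t < 1 ->
    (1 - a * t * x%:R - (1 - a * t) ^+ x) / (t * ln (1 - t)) =
    binom_mean x (fun v => log_fact_kernel (F x v) t)) ->
  binom_mean x (fun v => integral01 (kernelf p a (x + v))) =
  binom_mean x (fun v => ln (F x v)`!%:R).
Proof.
move=> a01 hF; rewrite -integral01_binom_mean; last first.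
  by move=> v; exact: integrable01_kernelf.
transitivity (binom_mean x (fun v => integral01 (@log_fact_kernel R (F x v)))).
  rewrite -integral01_binom_mean; last first.
    by move=> v; exact: integrable01_log_fact_kernel.
  by apply: integral01_ext => t t01; rewrite binom_mean_kernelf// hF.
by apply: binom_mean_ext => v _; rewrite integral01_log_fact_kernel.
Qed.

Lemma binom_mean_g x : binom_mean x (fun v => g p (x + v)) =
  binom_mean x (fun v => ln 'C(x, v)%:R).
Proof.
pose I a v := integral01 (kernelf p a (x + v)).
transitivity (binom_mean x (I 1) + (-1 * binom_mean x (I p) +
    -1 * binom_mean x (I (1 - p)))).
  rewrite -!binom_meanZ -!binom_meanD; apply: binom_mean_ext => v _.
  by rewrite gE /I; ring.
rewrite (binom_mean_integral_kernelf (F := fun x v => x)); last 2 first.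
- by rewrite ler01 lexx.
- by move=> t _; rewrite binom_mean_cst /log_fact_kernel mul1r.
rewrite (binom_mean_integral_kernelf (F := fun x v => v)); last 2 first.
- by rewrite !ltW ?p0 ?p1.
- move=> t _; rewrite /log_fact_kernel.
  (* E (1 - t)^V = (1 - p t)^x, and E V = p x matches the linear term. *)
  transitivity ((t * ln (1 - t))^-1 * binom_mean x (fun v => 1 +
    ((- t) * v%:R + (-1) * (1 ^+ (x - v) * (1 - t) ^+ v)))).
    rewrite !binom_meanD !binom_meanZ !binom_mean_cst binom_mean_id binom_mean_exp.
    have -> : (1 - p) * 1 + p * (1 - t) = 1 - p * t by ring.
    by move: (_ ^+ x) => A; ring.
  by rewrite -binom_meanZ; apply: binom_mean_ext => v _; rewrite expr1n; ring.
rewrite (binom_mean_integral_kernelf (F := fun x v => (x - v)%N)); last 2 first.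
- by have := p0; have := p1 => ? ?; apply/andP; split; lra.
- move=> t _; rewrite /log_fact_kernel.
  (* Likewise E (1 - t)^(x - V) = (1 - (1 - p) t)^x. *)
  transitivity ((t * ln (1 - t))^-1 * binom_mean x (fun v => 1 - t * x%:R +
    (t * v%:R + (-1) * ((1 - t) ^+ (x - v) * 1 ^+ v)))).
    rewrite !binom_meanD !binom_meanZ !binom_mean_cst binom_mean_id binom_mean_exp.
    have -> : (1 - p) * (1 - t) + p * 1 = 1 - (1 - p) * t by ring.
    by move: (_ ^+ x) => A; ring.
  rewrite -binom_meanZ; apply: binom_mean_ext => v vx.
  rewrite expr1n natrB//; move: ((1 - t) ^+ (x - v)) => A; ring.
rewrite -!binom_meanZ -!binom_meanD; apply: binom_mean_ext => v vx.
have := bin_fact vx; move=> /(congr1 (fun n => ln (n%:R : R))).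
rewrite !natrM !lnM ?posrE ?mulr_gt0 ?ltr0n ?fact_gt0 ?bin_gt0// => <-; ring.
Qed.

Lemma Ydist_add x v : (v <= x)%N -> Ydist p x (x + v) = binom_mass x v.
Proof.
move=> vx; rewrite /Ydist leq_addr mul2n -addnn leq_add2l vx/=.
by rewrite addKn subnDl.
Qed.

Lemma Ydist_eq0 x y : ~~ (x <= y <= 2 * x)%N -> Ydist p x y = 0.
Proof. by rewrite /Ydist => /negbTE ->. Qed.

Lemma binom_mass_gt0 x v : (v <= x)%N -> 0 < binom_mass x v.
Proof.
move=> vx; rewrite !mulr_gt0 ?exprn_gt0 ?ltr0n ?bin_gt0//.
by rewrite subr_gt0 p1.
Qed.

(** Partial sums are constant once they pass 2 x, so the limit exists without any sign condition;
    the remaining terms are reindexed by y = x + v. *)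
Lemma esum_Ydist_support x (F : nat -> \bar R) (G : nat -> R) : (1 <= x)%N ->
  (forall y, ~~ (x <= y <= 2 * x)%N -> F y = 0%E) ->
  (forall v, (v <= x)%N -> F (x + v)%N = (binom_mass x v * G v)%:E) ->
  (\sum_(1 <= y <oo) F y = (binom_mean x G)%:E)%E.
Proof.
move=> x1 F0 FG; apply: lim_near_cst; first exact: ereal_hausdorff.
exists (2 * x).+1 => //= n /= hn.
rewrite (@big_cat_nat _ _ _ x)//=; last by lia.
rewrite [X in (X + _)%E]big_nat_cond big1 ?add0e; last first.
  by move=> i; rewrite andbT => ix; apply: F0; lia.
rewrite (@big_cat_nat _ _ _ (2 * x).+1)//=; last by lia.
rewrite [X in (_ + X)%E]big_nat_cond [X in (_ + X)%E]big1 ?adde0; last first.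
  by move=> i; rewrite andbT => ix; apply: F0; lia.
have -> : ((2 * x).+1 = x.+1 + x)%N by lia.
rewrite -{1}[x]add0n big_addn addnK /binom_mean -sumEFin.
by apply: eq_big_nat => v /andP[_ vx]; rewrite addnC FG.
Qed.

Lemma pmf_mean_Ydist x : (1 <= x)%N ->
  pmf_mean (Ydist p x) = (binom_mean x (fun v => (x + v)%:R))%:E.
Proof.
move=> x1; apply: esum_Ydist_support => // [y hy|v vx].
  by rewrite Ydist_eq0// mulr0.
by rewrite Ydist_add// mulrC.
Qed.

Lemma KL_Ydist_Yq q x : 0 < q < 1 -> 0 < y0 p q -> (1 <= x)%N ->
  (KL (Ydist p x) (Yq p q) =
    (- ln (y0 p q))%:E - pmf_mean (Ydist p x) * (ln q)%:E)%E.
Proof.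
move=> /andP[q0 q1] y00 x1.
have W0 y : 0 < Yq_weight p q y by rewrite mulr_gt0 ?exprn_gt0 ?expR_gt0.
have Q0 y : 0 < Yq p q y by rewrite mulr_gt0.
pose G v := ln (binom_mass x v / Yq p q (x + v)).
have -> : KL (Ydist p x) (Yq p q) = (binom_mean x G)%:E.
  apply: esum_Ydist_support => // [y hy|v vx].
    by rewrite /KL_term Ydist_eq0// eqxx.
  by rewrite /KL_term Ydist_add// !gt_eqF// binom_mass_gt0.
rewrite pmf_mean_Ydist//.
transitivity ((- ln (y0 p q) - binom_mean x (fun v => (x + v)%:R) * ln q)%:E);
  last by [].
congr EFin.
(* Apart from ln C(x, v) - g, whose expectation is 0 by [binom_mean_g], the log-ratio is affine in
   v. *)
have GE v : (v <= x)%N -> G v = ln 'C(x, v)%:R + (-1 * g p (x + v) +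
   ((x%:R * (ln (1 - p) + binary_entropy p / (1 + p)) - ln (y0 p q)) +
    ((ln p - ln (1 - p) + binary_entropy p / (1 + p)) * v%:R
     + (- ln q) * (x + v)%:R))).
  move=> vx; have p10 : 0 < 1 - p by rewrite subr_gt0 p1.
  have pp : 0 < p by exact: p0.
  rewrite /G ln_div ?posrE ?binom_mass_gt0// /binom_mass /Yq /Yq_weight.
  rewrite !lnM ?posrE ?mulr_gt0 ?exprn_gt0 ?expR_gt0 ?ltr0n ?bin_gt0//.
  rewrite expRK !lnXn// -[ln p *+ v]mulr_natl -[ln (1 - p) *+ _]mulr_natl.
  by rewrite -[ln q *+ _]mulr_natl natrB// natrD; ring.
rewrite (binom_mean_ext GE) !binom_meanD !binom_meanZ binom_mean_g.
rewrite !binom_mean_cst binom_mean_id.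
move: (binom_mean x (fun v => (x + v)%:R)) (binom_mean x _) => E C.
have p10 : 1 + p != 0 by rewrite gt_eqF// addr_gt0// p0.
(* With E V = x p, the terms free of q and [y0] add up to x ((1 - p) ln (1 - p) + p ln p + h(p)) =
   0. *)
by rewrite /binary_entropy; field.
Qed.

End BinomialMean.

(** * Growth of g and summability of the weights *)

Section Growth.
Variables (R : realType) (p : R).
Hypothesis hp : 0 < p < 1.
Implicit Types (s t a q : R) (y : nat).

(** Integrating from -1 gives two-sided derivatives at 0 and 1 as well. *)
Lemma antiderivative_around01 (n : R -> R) : continuous n ->
  exists F : R -> R, forall t, -1 < t < 2 -> is_derive t 1 F (n t).
Proof.
move=> cn.
exists (fun x => \int[@lebesgue_measure R]_(t in `[-1, x]) n t) => t /andP[t0 t2].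
have i2 : (@lebesgue_measure R).-integrable `[-1, 2] (EFin \o n).
  apply: continuous_compact_integrable; first exact: segment_compact.
  exact: continuous_subspaceT.
have [dF F'] := continuous_FTC1_closed t2 i2 t0 (cn t).
by split; [exact: dF|rewrite -derive1E; exact: F'].
Qed.

Lemma is_derive_scale_arg (F : R -> R) a t d : is_derive (a * t) 1 F d ->
  is_derive t 1 (fun x => a * F (a * x)) (a ^+ 2 * d).
Proof.
move=> dF; have h := is_deriveZ a (is_derive_id t (1 : R)).
have := is_derive1_comp (g := fun x : R => a * x) dF h.
move=> /(is_deriveZ a) h2; apply: (is_derive_eq h2).
by rewrite /GRing.scale/= mulr1; ring.
Qed.

(** On ]0, 1[ this is M(t) / t^2 of the overview, in a form continuous at 0. *)
Definition second_diff_gap y t := second_diff p y t -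
  p ^+ 2 * second_diff p y (p * t) - (1 - p) ^+ 2 * second_diff p y ((1 - p) * t).

Lemma continuous_second_diff_gap y : continuous (second_diff_gap y).
Proof.
have c a : continuous (fun t => a ^+ 2 * second_diff p y (a * t)).
  move=> t; apply: cvgM; first exact: cvg_cst.
  apply: (@continuous_comp _ _ _ (fun t => a * t) (second_diff p y)).
    by apply: cvgM; [exact: cvg_cst|exact: cvg_id].
  exact: continuous_second_diff.
move=> t; apply: cvgB; last exact: c.
apply: cvgB; last exact: c.
exact: continuous_second_diff.
Qed.

Lemma second_diff_le y t : 0 < t < 1 -> second_diff p y t <= y%:R / (1 + p) / t.
Proof.
move=> /andP[t0 t1]; have h := second_diffE hp y (ltW t1).
have z0 := zroot_ge0 hp (ltW t1).
have z1 : zroot p t <= 1 by apply: zroot_le1 => //; rewrite !ltW.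
have zy : zroot p t ^+ y <= 1 by apply: exprn_ile1.
rewrite ler_pdivlMr// -(ler_pM2l t0); lra.
Qed.

(** Rescaling t turns the three terms into values of one antiderivative [F], leaving the increments
    of [F] over [p, 1] and [1 - p, 1] with weights p and 1 - p. The bound y / ((1 + p) t) on the
    integrand then produces the entropy. *)
Lemma integral01_second_diff_gap y :
  integral01 (second_diff_gap y) <= y%:R * binary_entropy p / (1 + p).
Proof.
have p0 := param_gt0 hp; have p1 := param_lt1 hp.
have [F dF] := antiderivative_around01 (@continuous_second_diff R p hp y).
pose G x := F x - p * F (p * x) - (1 - p) * F ((1 - p) * x).
have dG t : 0 <= t <= 1 -> is_derive t 1 G (second_diff_gap y t).
  move=> /andP[t0 t1].
  have h1 : is_derive t 1 F (second_diff p y t) by apply: dF; apply/andP; split; lra.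
  have h2 : is_derive (p * t) 1 F (second_diff p y (p * t)).
    by apply: dF; apply/andP; split; nra.
  have h3 : is_derive ((1 - p) * t) 1 F (second_diff p y ((1 - p) * t)).
    by apply: dF; apply/andP; split; nra.
  exact: is_deriveB (is_deriveB h1 (is_derive_scale_arg h2)) (is_derive_scale_arg h3).
have cG t : 0 <= t <= 1 -> {for t, continuous G}.
  move=> /dG[+ _].
  by move=> /derivable1_diffP/differentiable_continuous.
(* By [second_diff_le], F - y / (1 + p) ln has nonpositive derivative; the mean value theorem on
   [a, 1] concludes. *)
have Fle a : 0 < a < 1 -> F 1 - F a <= y%:R / (1 + p) * - ln a.
  move=> /andP[a0 a1].
  have dH t : 0 < t <= 1 -> is_derive t 1 (fun s => F s - y%:R / (1 + p) * ln s)
      (second_diff p y t - y%:R / (1 + p) * t^-1).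
    move=> /andP[t0 t1].
    have h1 : is_derive t 1 F (second_diff p y t) by apply: dF; apply/andP; split; lra.
    exact: is_deriveB h1 (is_deriveZ _ (is_derive1_ln t0)).
  have [||c cin e] := @MVT R (fun s => F s - y%:R / (1 + p) * ln s)
      (fun t => second_diff p y t - y%:R / (1 + p) * t^-1) a 1 a1.
  - move=> t; rewrite in_itv/= => /andP[at_ t1]; apply: dH; apply/andP; split; lra.
  - apply: derivable_within_continuous => t; rewrite in_itv/= => /andP[at_ t1].
    have : 0 < t <= 1 by apply/andP; split; lra.
    by move=> /dH[].
  move: cin e; rewrite in_itv/= => /andP[ac c1]; rewrite ln1 mulr0 subr0.
  have c01 : 0 < c < 1 by apply/andP; split; lra.
  have := second_diff_le y c01; move: (_ / (1 + p) / c) => W hW.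
  nra.
have -> : integral01 (second_diff_gap y) = G 1 - G 0.
  apply: integral01_FTC2.
  - exact/continuous_subspaceT/continuous_second_diff_gap.
  - by move=> t /andP[t0 t1]; apply: dG; rewrite !ltW.
  - by apply: cvg_at_right_filter; apply: cG; rewrite lexx ler01.
  - by apply: cvg_at_left_filter; apply: cG; rewrite lexx ler01.
(* The multiples of F 0 cancel since p + (1 - p) = 1. *)
have -> : G 1 - G 0 = p * (F 1 - F p) + (1 - p) * (F 1 - F (1 - p)).
  by rewrite /G !mulr1 !mulr0; ring.
have -> : y%:R * binary_entropy p / (1 + p) = p * (y%:R / (1 + p) * - ln p)
    + (1 - p) * (y%:R / (1 + p) * - ln (1 - p)).
  by rewrite /binary_entropy; field; rewrite gt_eqF//; lra.
by apply: lerD; rewrite ler_pM2l ?subr_gt0//; apply: Fle => //;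
  apply/andP; split; lra.
Qed.

Lemma integrable01_onem_expr_sum y :
  integrable01 (fun t : R => \sum_(0 <= j < y) 1 * (1 - t) `^ j%:R).
Proof. by apply: integrable01_sum => j; exact: integrable01_onem_powR. Qed.

(** Writes (1 - (1 - t)^y) / t as a geometric sum, whose integral is the y-th harmonic number. *)
Lemma onem_expr_sum y t : 0 < t < 1 ->
  t * (\sum_(0 <= j < y) 1 * (1 - t) `^ j%:R) = 1 - (1 - t) ^+ y.
Proof.
move=> /andP[t0 t1]; elim: y => [|y IHy]; first by rewrite big_nil mulr0 subrr.
rewrite big_nat_recr//= mulrDr IHy mul1r powR_mulrn ?subr_ge0 1?ltW//.
by rewrite exprS; ring.
Qed.

Lemma second_diff_gap_log_ratio y t : 0 < t < 1 ->
  second_diff_gap y t * log_ratio t <=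
  second_diff_gap y t + \sum_(0 <= j < y) 1 * (1 - t) `^ j%:R.
Proof.
move=> t01; have S := onem_expr_sum y t01; have r := log_ratio_bounds t01.
have p0 := param_gt0 hp; have p1 := param_lt1 hp.
move: S; set S := \sum_(0 <= j < y) _ => hS.
case/andP: t01 r => t0 t1 /andP[r0 r1].
have tle : 0 <= t <= 1 by rewrite !ltW.
have B0 : 0 <= 1 - (1 - t) ^+ y.
  by rewrite subr_ge0 exprn_ile1//; lra.
have S0 : 0 <= S by rewrite -(pmulr_rge0 _ t0) hS.
have zt : (1 - t) ^+ y <= zroot p t ^+ y.
  apply: lerXn2r; rewrite ?nnegrE; [lra|exact: zroot_ge0 (ltW t1)|].
  exact: zroot_ge_onem.
have zle a : 0 < a < 1 -> zroot p (a * t) ^+ y <= 1.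
  move=> /andP[a0 a1]; have at1 : a * t <= 1 by nra.
  apply: exprn_ile1; first exact: zroot_ge0.
  by apply: zroot_le1 => //; apply/andP; split; nra.
have z2 := zle p hp.
have z3 : zroot p ((1 - p) * t) ^+ y <= 1 by apply: zle; apply/andP; split; lra.
have m1 := second_diffE hp y (ltW t1).
have pt1 : p * t <= 1 by nra.
have p't1 : (1 - p) * t <= 1 by nra.
have m2 := second_diffE hp y pt1; have m3 := second_diffE hp y p't1.
have hm : t ^+ 2 * second_diff_gap y t =
    1 + zroot p t ^+ y - zroot p (p * t) ^+ y - zroot p ((1 - p) * t) ^+ y.
  have -> : t ^+ 2 * second_diff_gap y t = t ^+ 2 * second_diff p y t -
      (p * t) ^+ 2 * second_diff p y (p * t) -
      ((1 - p) * t) ^+ 2 * second_diff p y ((1 - p) * t).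
    by rewrite /second_diff_gap; ring.
  by rewrite m1 m2 m3; ring.
have hm2 : - (t ^+ 2 * second_diff_gap y t) <= t * S by rewrite hm hS; lra.
move: hm2; move: (second_diff_gap y t) (log_ratio t) r0 r1 => m r r0 r1 hm2.
have hm3 : - (t * m) <= S by rewrite -(ler_pM2l t0); lra.
(* If m >= 0, use r <= 1. Otherwise m r - m = - m (1 - r) <= - m t <= S, because 1 - r <= t. *)
have [m0|m0] := leP 0 m; nra.
Qed.

Lemma g_le y : g p y <= y%:R * binary_entropy p / (1 + p) +
  \sum_(0 <= j < y) (1 + j%:R)^-1.
Proof.
have p0 := param_gt0 hp; have p1 := param_lt1 hp.
have a1 : 0 <= (1 : R) <= 1 by rewrite ler01 lexx.
have ap : 0 <= p <= 1 by rewrite !ltW.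
have ap' : 0 <= 1 - p <= 1 by apply/andP; split; lra.
have i1 := integrable01_kernelf hp y a1; have i2 := integrable01_kernelf hp y ap.
have i3 := integrable01_kernelf hp y ap'.
have im : integrable01 (second_diff_gap y).
  exact/continuous01_integrable/continuous_subspaceT/continuous_second_diff_gap.
have -> : \sum_(0 <= j < y) (1 + j%:R)^-1 =
    integral01 (fun t : R => \sum_(0 <= j < y) 1 * (1 - t) `^ j%:R).
  rewrite integral01_sum; last by move=> j; exact: integrable01_onem_powR.
  by apply: eq_bigr => j _; rewrite integral01_onem_powR// mul1r.
apply: le_trans (lerD (integral01_second_diff_gap y) (lexx _)).
rewrite gE// -!integral01B//; last exact: integrable01B.
rewrite -integral01D//; last exact: integrable01_onem_expr_sum.
apply: integral01_le.
- by apply: integrable01B => //; exact: integrable01B.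
- by apply: integrable01D => //; exact: integrable01_onem_expr_sum.
move=> t t01; apply: le_trans (second_diff_gap_log_ratio y t01).
rewrite (kernelfE hp y a1 t01) (kernelfE hp y ap t01) (kernelfE hp y ap' t01).
by rewrite /second_diff_gap expr1n !mul1r !mulrBl.
Qed.

Lemma expR_harmonic y : (0 < y)%N ->
  expR (\sum_(0 <= j < y) (1 + j%:R)^-1) <= expR 1 * y%:R :> R.
Proof.
case: y => // y _; elim: y => [|y IHy].
  by rewrite big_nat1 addr0 invr1 mulr1.
have y0 : 0 < y.+1%:R :> R by [].
rewrite big_nat_recr//= expRD.
apply: le_trans (ler_wpM2r (expR_ge0 _) IHy) _.
rewrite -mulrA ler_pM2l ?expR_gt0//.
(* With x = y + 1, exp (- 1 / (1 + x)) >= x / (1 + x), so one more harmonic term costs at most the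
   factor (1 + x) / x. *)
have := expR_ge1Dx (- (1 + y.+1%:R)^-1 : R).
rewrite expRN -(natr1 y.+1) (addrC _ 1); move: (y.+1%:R) y0 => x x0.
have -> : 1 - (1 + x)^-1 = x / (1 + x) by field; rewrite gt_eqF//; lra.
have x10 : 0 < 1 + x by lra.
have E0 := expR_gt0 (1 + x)^-1.
by rewrite ler_pdivrMr// mulrC ler_pdivlMr.
Qed.

(** Each of the n terms of (1 - s) (1 + s + ... + s^(n - 1)) = 1 - s^n is at least (1 - s) s^n. *)
Lemma mul_expr_le s n : 0 < s < 1 -> n%:R * (1 - s) * s ^+ n <= 1 - s ^+ n.
Proof.
move=> /andP[s0 s1]; elim: n => [|n IHn]; first by rewrite !mul0r subrr.
have sn1 : s ^+ n <= 1 by rewrite exprn_ile1 ?ltW.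
have sn0 : 0 <= s ^+ n by rewrite exprn_ge0 ?ltW.
rewrite -natr1 exprS; move: (n%:R) (s ^+ n) IHn sn1 sn0 => m A h A1 A0.
have h1 : s * (m * (1 - s) * A) <= s * (1 - A) by rewrite ler_pM2l.
have h2 : 0 <= (1 - s) * (1 - s * A) by apply: mulr_ge0; nra.
lra.
Qed.

(** The weight is at most e y q^y. Splitting q^y = s^y s^y with s the square root of q, one factor
    absorbs y and the other stays as a summable geometric bound. *)
Lemma Yq_weight_le q y : 0 < q < 1 -> (0 < y)%N ->
  Yq_weight p q y <= expR 1 / (1 - Num.sqrt q) * Num.sqrt q ^+ y.
Proof.
move=> /andP[q0 q1] y0; pose s := Num.sqrt q.
have s0 : 0 < s by rewrite sqrtr_gt0.
have qE : q = s ^+ 2 by rewrite sqr_sqrtr// ltW.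
have s1 : s < 1 by rewrite -(expr_lt1 (n := 2)) -?qE// ltW.
have s01 : 0 < s < 1 by rewrite s0.
have qy : 0 <= q ^+ y by rewrite exprn_ge0// ltW.
rewrite /Yq_weight -/s.
apply: (@le_trans _ _ (q ^+ y * (expR 1 * y%:R))).
  apply: ler_wpM2l => //; apply: le_trans (expR_harmonic y0).
  by rewrite ler_expR; have := g_le y; lra.
have := mul_expr_le y s01; have sy0 : 0 <= s ^+ y by rewrite exprn_ge0// ltW.
rewrite qE -exprM mulnC exprM expr2; move: (s ^+ y) (y%:R) sy0 => A m A0 h.
have s10 : 0 < 1 - s by rewrite subr_gt0.
rewrite [leRHS]mulrAC ler_pdivlMr//.
have -> : A * A * (expR 1 * m) * (1 - s) = expR 1 * A * (m * (1 - s) * A) by ring.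
by rewrite -[leRHS]mulr1 ler_wpM2l ?mulr_ge0 ?expR_ge0//; lra.
Qed.

Lemma Yq_weight_gt0 q y : 0 < q -> 0 < Yq_weight p q y.
Proof. by move=> q0; rewrite mulr_gt0 ?exprn_gt0 ?expR_gt0. Qed.

Lemma Yq_sum_lty q : 0 < q < 1 -> (Yq_sum p q < +oo)%E.
Proof.
move=> q01; have /andP[q0 q1] := q01; pose s := Num.sqrt q.
have s0 : 0 < s by rewrite sqrtr_gt0.
have s1 : s < 1 by rewrite -(expr_lt1 (n := 2)) ?sqr_sqrtr// ltW.
have s10 : 0 < 1 - s by rewrite subr_gt0.
have C0 : 0 <= expR 1 / (1 - s) by rewrite divr_ge0 ?expR_ge0// ltW.
apply: (@le_lt_trans _ _ (expR 1 / (1 - s) / (1 - s))%:E); last exact: ltry.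
apply: lime_le.
  by apply: is_cvg_nneseries => n _ _; rewrite lee_fin ltW// Yq_weight_gt0.
apply: nearW => n; rewrite sumEFin lee_fin.
apply: (@le_trans _ _ (\sum_(1 <= y < n) (expR 1 / (1 - s) * s ^+ y))).
  by rewrite big_nat_cond [leRHS]big_nat_cond; apply: ler_sum => y;
    rewrite andbT => /andP[y1 _]; exact: Yq_weight_le.
rewrite -mulr_sumr ler_wpM2l//.
apply: (@le_trans _ _ (\sum_(0 <= y < n) s ^+ y)).
  case: n => [|n]; first by rewrite !big_geq.
  by rewrite [leRHS]big_nat_recl// big_add1/= ler_wpDl.
rewrite -[leRHS]mul1r ler_pdivlMr//.
have -> : (\sum_(0 <= y < n) s ^+ y) * (1 - s) = 1 - s ^+ n.
  elim: n => [|n IHn]; first by rewrite big_nil mul0r subrr.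
  by rewrite big_nat_recr//= mulrDl IHn exprS; ring.
by rewrite gerBl exprn_ge0// ltW.
Qed.

Lemma Yq_sum_gt0 q : 0 < q -> (0 < Yq_sum p q)%E.
Proof.
move=> q0; apply: (@lt_le_trans _ _ (\sum_(1 <= y < 2) (Yq_weight p q y)%:E)%E).
  by rewrite big_nat1 lte_fin Yq_weight_gt0.
by apply: nneseries_lim_ge => n _ _; rewrite lee_fin ltW// Yq_weight_gt0.
Qed.

(** Both finiteness and positivity of the sum enter: [fine] sends an infinite sum to 0, and the
    inverse of 0 is 0. *)
Lemma y0_gt0 q : 0 < q < 1 -> 0 < y0 p q.
Proof.
move=> q01; rewrite /y0 invr_gt0 fine_gt0// Yq_sum_lty// andbT Yq_sum_gt0//.
by case/andP: q01.
Qed.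

Lemma Yq_pmf q : 0 < q < 1 -> is_pmf (Yq p q).
Proof.
move=> q01; have /andP[q0 _] := q01; have h0 := y0_gt0 q01; split.
  by move=> y _; rewrite mulr_ge0 ?ltW// Yq_weight_gt0.
have W0 y : (0 <= (Yq_weight p q y)%:E)%E by rewrite lee_fin ltW// Yq_weight_gt0.
under eq_eseriesr do rewrite EFinM.
rewrite nneseriesZl// -/(Yq_sum p q).
have /fineK <- : Yq_sum p q \is a fin_num.
  by rewrite ge0_fin_numE ?Yq_sum_lty// ltW// Yq_sum_gt0.
by rewrite -EFinM /y0 mulVf// -invr_eq0 gt_eqF.
Qed.

End Growth.

Theorem mainTheorem6 (R : realType) (p q : R)
    (hp : 0 < p < 1) (hq : 0 < q < 1) :
  [/\ (Yq_sum p q < +oo)%E,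
      is_pmf (Yq p q)
    & forall x : nat, (1 <= x)%N ->
        (KL (Ydist p x) (Yq p q) =
         (- ln (y0 p q))%:E - pmf_mean (Ydist p x) * (ln q)%:E)%E].
Proof.
split; [exact: Yq_sum_lty|exact: Yq_pmf|].
by move=> x x1; apply: KL_Ydist_Yq => //; exact: y0_gt0.
Qed.
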